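(* For every integer $n \geq 3$, the number $c_3(n)$ of cyclic permutations of length $n$ in the $\sigma$-class with signature $\sigma_3 = +-+$ satisfies \[ c_3(n) = \frac{L_3^*(n;\sigma_3)}{4}. \]
   Context: $\mathcal S_n$ is the set of permutations of $[n]=\{1,\dots,n\}$, written in one-line notation $\pi=\pi_1\cdots\pi_n$. A permutation is cyclic if its cycle decomposition consists of a single $n$-cycle; $\mathcal C_n$ is the set of cyclic permutations in $\mathcal S_n$. For a signature $\sigma=\sigma^0\sigma^1\cdots\sigma^{k-1}\in\{+,-\}^k$, the $\sigma$-class $\mathcal S^\sigma_n$ is the set of $\pi\in\mathcal S_n$ for which there exist integers $0=e_0\le e_1\le\cdots\le e_k=n$ such that for each $i\in\{0,\dots,k-1\}$ the segment $\pi_{e_i+1}\pi_{e_i+2}\cdots\pi_{e_{i+1}}$ is increasing if $\sigma^i=+$ and decreasing if $\sigma^i=-$. Set $\mathcal C_n^\sigma=\mathcal C_n\cap\mathcal S_n^\sigma$ and $c_3(n)=|\mathcal C_n^{+-+}|$. A word of length $m$ on $k$ letters is a sequence $s=s_1\cdots s_m$ with $s_j\in\{0,1,\dots,k-1\}$; it is primitive if it is not of the form $q^r$ (concatenation of $r$ copies of a word $q$) for any $r>1$. A necklace is an equivalence class of words under cyclic rotation; it is primitive if its representatives are primitive. $L_k(m)$ denotes the number of primitive necklaces of length $m$ on $k$ letters. For $\sigma\in\{+,-\}^k$ let $T_\sigma^-=\{i:\sigma^i=-\}$ and for a word $s$ let $o_\sigma(s)=|\{j: s_j\in T_\sigma^-\}|$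 (this is invariant under rotation). $L_k(m;\sigma)$ denotes the number of primitive necklaces of length $m$ on $k$ letters whose representatives $s$ have $o_\sigma(s)$ odd, with the convention $L_k(m;\sigma)=0$ if $m$ is not an integer. Finally $L_k^*(n;\sigma)=L_k(n)+L_k(\tfrac n2;\sigma)$ (so $L_k^*(n;\sigma)=L_k(n)$ when $n$ is odd). *)

(* Defs.v *)
From mathcomp Require Import all_boot all_order all_algebra all_fingroup.
From mathcomp Require Import boolp.
Set Implicit Arguments. Unset Strict Implicit. Unset Printing Implicit Defensive.

(* Permutations of [n] are 'S_n = {perm 'I_n}; position j (0-based) holds
   value s j (0-based).  Values are shifted by 1 w.r.t. the paper, which does
   not affect monotonicity. *)

Definition cyclic_perm n (s : 'S_n) : bool := #|porbits s| == 1.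

(* signature: seq bool, true = '+', false = '-' *)
Definition in_sigma_class (sigma : seq bool) n (s : 'S_n) : Prop :=
  exists e : nat -> nat,
    [/\ e 0 = 0, e (size sigma) = n,
        (forall i, i < size sigma -> e i <= e i.+1) &
        (forall i, i < size sigma -> forall a b : 'I_n,
            val b = (val a).+1 -> e i <= a -> b < e i.+1 ->
            if nth true sigma i then (s a < s b)%N else (s b < s a)%N)].

Definition sigma_class_cyclic (sigma : seq bool) n : {set 'S_n} :=
  [set s : 'S_n | cyclic_perm s && `[< in_sigma_class sigma s >]].

Definition sigma3t : 3.-tuple bool := [tuple true; false; true].

Definition c3 n : nat := #|sigma_class_cyclic (val sigma3t) n|.

Definition word k m := (m.-tuple 'I_k).

Definition primitive k m (w : word k m) : Prop :=
  ~ exists (q : seq 'I_k) (r : nat), 1 < r /\ val w = flatten (nseq r q).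

Definition necklace k m (w : word k m) : {set word k m} :=
  [set w' : word k m | [exists i : 'I_m.+1, val w' == rot i w]].

Definition Lk k m : nat :=
  #|[set necklace w | w in [set w : word k m | `[< primitive w >] ]]|.

Definition o_sigma k (sigma : k.-tuple bool) m (w : word k m) : nat :=
  count (fun a => ~~ tnth sigma a) w.

Definition Lk_sig k (sigma : k.-tuple bool) m : nat :=
  #|[set necklace w | w in
       [set w : word k m | `[< primitive w >] && odd (o_sigma sigma w)]]|.

Definition Lk_star k (sigma : k.-tuple bool) n : nat :=
  Lk k n + (if odd n then 0 else Lk_sig sigma n./2).

(* Main.v *)
Require Import Defs.
From mathcomp Require Import all_boot all_order all_algebra all_fingroup.
From mathcomp Require Import boolp zify.
Set Implicit Arguments. Unset Strict Implicit. Unset Printing Implicit Defensive.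

(* Double count the pairs (w, r) of a ternary word w of length n and a ranking r
   of its n cyclic shifts such that r respects the first letters and, among
   shifts with the same first letter, deleting that letter preserves the ranking
   for a positive letter and reverses it for a negative one.
   For a fixed w, the ranking is forced by the signed lexicographic order except
   on equal shifts.  So there is one ranking if w is primitive.  If w = q^e with
   q primitive and e > 1, shifting by |q| permutes e equal shifts cyclically and
   is monotone for r, increasing or decreasing according to the parity of the
   number of negative letters of q; this forces e = 2 and odd parity, and then
   there are two rankings.
   For a fixed r, moving by one letter conjugates to a cyclic permutation s, n
   rankings giving the same s, and w becomes a cutting of the one-line notation
   of s into increasing, decreasing and increasing segments.  The descents of s
   form a nonempty interval of positions, and each of its two ends leaves two
   choices for the corresponding cut: there are four cuttings. *)

(** * Finite words read periodically, and their periods *)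

Section PeriodicReading.
Variables (T : Type) (x0 : T).
Implicit Types (s q : seq T).

(** Reading modulo the size makes rotations into translations of a function on [nat]; the empty word
    reads as the constant [x0]. *)
Definition cyc s j := nth x0 s (j %% size s).

Lemma cyc_modn s j : cyc s (j %% size s) = cyc s j.
Proof. by rewrite /cyc modn_mod. Qed.

Lemma cycDsize s j : cyc s (j + size s) = cyc s j.
Proof. by rewrite /cyc modnDr. Qed.

Lemma cyc_small s j : j < size s -> cyc s j = nth x0 s j.
Proof. by move=> lt_js; rewrite /cyc modn_small. Qed.

Lemma cyc_rot d s j : d <= size s -> cyc (rot d s) j = cyc s (j + d).
Proof.
move=> le_ds; case: (posnP (size s)) => [/size0nil -> | s_gt0].
  by rewrite /rot /cyc /= !nth_nil.
rewrite /cyc size_rot -modnDml; set i := j %% _.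
have lt_i : i < size s by rewrite ltn_pmod.
rewrite /rot nth_cat size_drop; case: ltnP => [lt_id | le_di].
  by rewrite nth_drop modn_small; [rewrite addnC | lia].
rewrite nth_take; last lia.
congr (nth _ _ _); have -> : i + d = (i - (size s - d)) + size s by lia.
by rewrite modnDr modn_small //; lia.
Qed.

Lemma size_flatten_nseq r q : size (flatten (nseq r q)) = r * size q.
Proof. by rewrite size_flatten /shape map_nseq sumn_nseq mulnC. Qed.

Lemma nth_flatten_nseq r q i :
  i < r * size q -> nth x0 (flatten (nseq r q)) i = cyc q i.
Proof.
elim: r i => [|r IHr] i //=; rewrite mulSn nth_cat => lt_i.
case: ltnP => [lt_iq | le_qi]; first by rewrite cyc_small.
rewrite IHr; last lia.
by rewrite -{2}(subnK le_qi) cycDsize.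
Qed.

Lemma cyc_flatten_nseq r q j : 0 < r -> cyc (flatten (nseq r q)) j = cyc q j.
Proof.
move=> r_gt0; case: (posnP (size q)) => [/size0nil -> | q_gt0].
  by rewrite /cyc !nth_default // size_flatten_nseq muln0.
rewrite {1}/cyc nth_flatten_nseq size_flatten_nseq ?ltn_pmod ?muln_gt0 ?r_gt0 //.
by rewrite /cyc modn_dvdm ?dvdn_mull.
Qed.

Lemma cyc_cat_self q j : cyc (q ++ q) j = cyc q j.
Proof. by have := cyc_flatten_nseq q j (isT : 0 < 2); rewrite /= cats0. Qed.

Definition period (W : nat -> T) d := forall j, W (j + d) = W j.

Lemma period_size s : period (cyc s) (size s).
Proof. exact: cycDsize. Qed.

Lemma periodM W d r : period W d -> period W (r * d).
Proof.
move=> Wd; elim: r => [|r IHr] j; first by rewrite addn0.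
by rewrite mulSnr addnA Wd IHr.
Qed.

(** By Bezout, the gcd plus a multiple of [b] is a multiple of [a]. *)
Lemma period_gcdn W a b : period W a -> period W b -> period W (gcdn a b).
Proof.
move=> Wa Wb j; case: (posnP a) => [-> | a_gt0]; first by rewrite gcd0n Wb.
case: (egcdnP b a_gt0) => u v def_g _.
by rewrite -(periodM v Wb) -addnA [gcdn _ _ + _]addnC -def_g periodM.
Qed.

Lemma period_cyc_flatten s g :
    g %| size s -> period (cyc s) g ->
  s = flatten (nseq (size s %/ g) (take g s)).
Proof.
case: (posnP (size s)) => [/size0nil -> _ _ | s_gt0 g_s sg]; first by rewrite div0n.
have le_g : g <= size s by exact: dvdn_leq.
have g_gt0 : 0 < g by exact: dvdn_gt0 g_s.
have sz_t : size (take g s) = g by rewrite size_takel.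
apply: (@eq_from_nth _ x0) => [|i lt_i].
  by rewrite size_flatten_nseq sz_t divnK.
rewrite nth_flatten_nseq ?sz_t ?divnK // /cyc sz_t nth_take ?ltn_pmod //.
rewrite -cyc_small // {1}(divn_eq i g) addnC periodM // cyc_small //.
exact: leq_trans (ltn_pmod _ _) le_g.
Qed.

End PeriodicReading.

(** * Primitive words and the number of primitive necklaces *)

Section Necklaces.
Variable k : nat.
Let x0 : 'I_k.+1 := ord0.

(** The gcd of a period with [m] is again a period, and if it were smaller than [m] it would display
    [w] as a proper power. *)
Lemma primitiveP m (w : word k.+1 m) : 0 < m ->
  primitive w <-> forall d, period (cyc x0 w) d -> m %| d.
Proof.
move=> m_gt0; have sz_w : size w = m by rewrite size_tuple.
split=> [prim_w d wd | per_w [q [r [r_gt1 def_w]]]].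
  have wm : period (cyc x0 w) m by rewrite -{2}sz_w; apply: period_size.
  have wg := period_gcdn wd wm; set g := gcdn d m in wg.
  have g_m : g %| size w by rewrite sz_w dvdn_gcdr.
  case: (ltnP 1 (m %/ g)) => [r_gt1 | r_le1].
    case: prim_w; exists (take g w), (m %/ g); split=> //.
    by have := period_cyc_flatten g_m wg; rewrite sz_w.
  have -> : m = g.
    rewrite sz_w in g_m; rewrite -{1}(divnK g_m).
    by move: m_gt0 r_le1; rewrite -{1}(divnK g_m); case: (m %/ g) => [|[]] //= _ _;
      rewrite mul1n.
  exact: dvdn_gcdl.
have def_m : m = r * size q by rewrite -sz_w def_w size_flatten_nseq.
have /per_w : period (cyc x0 w) (size q).
  by move=> j; rewrite def_w !cyc_flatten_nseq ?cycDsize //; lia.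
have q_gt0 : 0 < size q by move: m_gt0; rewrite def_m muln_gt0 => /andP[].
by move/(dvdn_leq q_gt0); rewrite def_m; nia.
Qed.

Lemma primitive_rot m (w w' : word k.+1 m) i : 0 < m -> i <= m ->
  val w' = rot i w -> primitive w -> primitive w'.
Proof.
move=> m_gt0 le_im def_w' /(primitiveP _ m_gt0) prim_w.
have sz_w : size w = m by rewrite size_tuple.
apply/(primitiveP _ m_gt0) => d w'd; apply: prim_w => j.
have cE t : cyc x0 w' t = cyc x0 w (t + i) by rewrite def_w' cyc_rot ?sz_w.
have := w'd (j + (m - i)); rewrite !cE.
rewrite (_ : _ + i = j + d + size w) ?cycDsize; last by rewrite sz_w; lia.
by rewrite (_ : _ + i = j + size w) ?cycDsize //; rewrite sz_w; lia.
Qed.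

Lemma mem_necklace m (w : word k.+1 m) : w \in necklace w.
Proof. by rewrite inE; apply/existsP; exists ord0; rewrite rot0. Qed.

Lemma necklaceE m (w : word k.+1 m) : 0 < m ->
  necklace w = [set rot_tuple (i : 'I_m) w | i : 'I_m].
Proof.
move=> m_gt0; apply/setP => v; rewrite inE; apply/existsP/imsetP.
  case=> i /eqP def_v; case: (ltnP i m) => [lt_im | le_mi].
    by exists (Ordinal lt_im) => //; apply: val_inj.
  exists (Ordinal m_gt0) => //; apply: val_inj.
  by rewrite /= def_v rot0 rot_oversize ?size_tuple.
case=> i _ ->; have lt_i : i < m.+1 by rewrite ltnS ltnW.
by exists (Ordinal lt_i).
Qed.

(** If the rotations by [i < i'] agreed, [i' - i] would be a period shorter than [m]. *)
Lemma card_primitive_necklace m (w : word k.+1 m) : 0 < m -> primitive w ->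
  #|necklace w| = m.
Proof.
move=> m_gt0 /(primitiveP _ m_gt0) prim_w.
have sz_w : size w = m by rewrite size_tuple.
rewrite necklaceE // card_imset ?card_ord //.
suff rot_lt (i i' : 'I_m) : i < i' -> rot_tuple i w <> rot_tuple i' w.
  move=> i i' eq_r; apply: val_inj.
  by case: (ltngtP i i') => // [/rot_lt[] | /rot_lt[]].
move=> lt_ii' /(congr1 val) /= eq_r.
have /prim_w : period (cyc x0 w) (i' - i).
  move=> j; have := cyc_rot x0 (j + (m - i)) (_ : i <= size w).
  rewrite sz_w eq_r cyc_rot ?sz_w; try by apply: ltnW.
  move=> /(_ (ltnW (ltn_ord i))).
  have lt_i := ltn_ord i.
  rewrite (_ : _ + i' = j + (i' - i) + size w) ?cycDsize; last by rewrite sz_w; lia.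
  by rewrite (_ : _ + i = j + size w) ?cycDsize //; rewrite sz_w; lia.
by move/dvdn_leq; have := ltn_ord i'; lia.
Qed.

Lemma necklace_eq m (w v : word k.+1 m) : 0 < m ->
  v \in necklace w -> necklace v = necklace w.
Proof.
move=> m_gt0; rewrite inE => /existsP[i /eqP def_v].
have sub_rot (u u' : word k.+1 m) j : j <= m -> val u' = rot j u ->
    necklace u' \subset necklace u.
  move=> le_jm def_u'; apply/subsetP => t; rewrite !necklaceE //.
  case/imsetP => l _ ->.
  have [l' le_l' def_l] : exists2 l', l' <= m & rot l u' = rot l' u.
    exists (if l + j <= m then l + j else l + j - m).
      by have := ltn_ord l; case: ifP; lia.
    by rewrite def_u' rot_add_mod ?size_tuple // ltnW.
  by rewrite -necklaceE // inE; apply/existsP; exists (inord l');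
    rewrite inordK //= def_l.
apply/eqP; rewrite eqEsubset (sub_rot _ _ _ _ def_v) -1?ltnS //=.
apply: (sub_rot v w (m - i)); first exact: leq_subr.
by have := rotK i w; rewrite /rotr size_rot size_tuple -def_v => ->.
Qed.

(** Group the words by necklace: rotation invariance makes each group a full necklace, and
    primitivity gives it [m] elements. *)
Lemma card_rot_invariant m (P : pred (word k.+1 m)) : 0 < m ->
    (forall w, P w -> primitive w) ->
    (forall w v i, P w -> val v = rot i w -> P v) ->
  #|[set w | P w]| = #|[set necklace w | w in [set w | P w]]| * m.
Proof.
move=> m_gt0 primP rotP.
rewrite -sum1_card (partition_big_imset (@necklace k.+1 m)) /=.
rewrite -sum_nat_const; apply: eq_bigr => N /imsetP[w].
rewrite inE => Pw ->; rewrite sum1dep_card.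
rewrite -[RHS](card_primitive_necklace m_gt0 (primP w Pw)).
apply: eq_card => v; rewrite !inE; apply/andP/existsP => [[_ /eqP eq_N]|].
  by have := mem_necklace v; rewrite eq_N inE => /existsP.
case=> i def_v; split; first by apply: rotP Pw (eqP def_v).
by apply/eqP/necklace_eq; rewrite // inE; apply/existsP; exists i.
Qed.

Lemma card_primitive_words m : 0 < m ->
  #|[set w : word k.+1 m | `[< primitive w >]]| = Lk k.+1 m * m.
Proof.
move=> m_gt0; apply: card_rot_invariant => // [w /asboolP // | w v i].
move=> /asboolP prim_w def_v; apply/asboolP; case: (leqP i m) => [le_im | lt_mi].
  exact: primitive_rot def_v prim_w.
suff -> : v = w by [].
by apply: val_inj; rewrite def_v rot_oversize // size_tuple ltnW.
Qed.

Lemma card_odd_primitive_words m (sigma : k.+1.-tuple bool) : 0 < m ->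
  #|[set w : word k.+1 m | `[< primitive w >] && odd (o_sigma sigma w)]|
    = Lk_sig sigma m * m.
Proof.
move=> m_gt0; apply: card_rot_invariant => // [w /andP[/asboolP] // | w v i].
move=> /andP[/asboolP prim_w odd_w] def_v; apply/andP; split; last first.
  by rewrite /o_sigma def_v (seq.permP (_ : perm_eq (rot i w) w)) // perm_rot.
apply/asboolP; case: (leqP i m) => [le_im | lt_mi].
  exact: primitive_rot def_v prim_w.
suff -> : v = w by [].
by apply: val_inj; rewrite def_v rot_oversize // size_tuple ltnW.
Qed.

End Necklaces.

(** * Permutations as rankings *)

Section Ranking.
Variable n : nat.

Lemma card_ord_lt (x : 'I_n) : #|[set y : 'I_n | y < x]| = x.
Proof.
rewrite -sum1dep_card -(big_ord_widen _ (fun=> 1)) ?sum1_card ?card_ord //.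
exact: ltnW.
Qed.

(** The value at [i] is the number of indices with a smaller value, so the order alone determines
    it. *)
Lemma perm_order_inj (r1 r2 : 'S_n) :
  (forall i j, (r1 i < r1 j) = (r2 i < r2 j)) -> r1 = r2.
Proof.
move=> eq_r; have rankE (r : 'S_n) i : val (r i) = #|[set j | r j < r i]|.
  rewrite -[LHS]card_ord_lt -[LHS](card_preimset _ (@perm_inj _ r)).
  by apply: eq_card => j; rewrite !inE.
apply/permP => i; apply: val_inj; rewrite (rankE r1 i) (rankE r2 i).
by apply: eq_card => j; rewrite !inE eq_r.
Qed.

Lemma perm_of_key (K : 'I_n -> nat) : injective K ->
  exists r : 'S_n, forall i j, (r i < r j) = (K i < K j).
Proof.
move=> injK; pose rk i := #|[set j | K j < K i]|.
have rk_lt i j : K i < K j -> rk i < rk j.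
  move=> lt_ij; apply: proper_card; apply/properP; split.
    by apply/subsetP => t; rewrite !inE => /ltn_trans->.
  by exists i; rewrite !inE ?ltnn.
have rk_bd i : rk i < n.
  rewrite -[ltnRHS](card_ord n) -cardsT; apply: proper_card.
  by apply/properP; split; [exact: subsetT | exists i; rewrite !inE ?ltnn].
have rk_inj : injective (fun i => Ordinal (rk_bd i)).
  move=> i j [eq_rk]; apply: injK.
  by case: (ltngtP (K i) (K j)) => // /rk_lt; rewrite eq_rk ltnn.
exists (perm rk_inj) => i j; rewrite !permE /=.
apply/idP/idP => [|/rk_lt //]; rewrite ltnNge => le_rk.
rewrite ltn_neqAle leqNgt (contra (@rk_lt j i)) ?andbT; last first.
  by apply: contra le_rk; apply: ltnW.
by apply: contra le_rk => /eqP /injK ->.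
Qed.

End Ranking.

(** * The signed lexicographic order, encoded by numbers *)

Section SignedWords.
Variables (k : nat) (sigma : k.+1.-tuple bool).
Implicit Types (W : nat -> 'I_k.+1).

Definition neg (a : 'I_k.+1) := ~~ tnth sigma a.

Definition parity W i l := odd (count neg (map W (iota i l))).

Lemma parityS W i l : parity W i l.+1 = neg (W i) (+) parity W i.+1 l.
Proof. by rewrite /parity /= oddD oddb. Qed.

Lemma parityD W i a b : parity W i (a + b) = parity W i a (+) parity W (i + a) b.
Proof. by rewrite /parity iotaD map_cat count_cat oddD. Qed.

Lemma parity_period W d i l : period W d -> parity W (i + d) l = parity W i l.
Proof.
move=> Wd; elim: l i => // l IHl i.
by rewrite !parityS Wd -addSn IHl.
Qed.

Lemma parity_cyc (q : seq 'I_k.+1) :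
  parity (cyc ord0 q) 0 (size q) = odd (count neg q).
Proof.
rewrite /parity; congr (odd (count _ _)); rewrite -[RHS](mkseq_nth ord0).
by apply/eq_in_map => i; rewrite mem_iota add0n => /andP[_ /(cyc_small ord0)->].
Qed.

(* The base-[k.+1] number whose digits are [W j], [W j.+1], ..., with every
   digit complemented after an odd number of negative letters: comparing these
   numbers is comparing shifts of [W] in the signed lexicographic order. *)
Fixpoint key W L j :=
  if L is L'.+1 then
    W j * k.+1 ^ L' +
    (if neg (W j) then k.+1 ^ L' - (key W L' j.+1).+1 else key W L' j.+1)
  else 0.

Lemma key_bound W L j : key W L j < k.+1 ^ L.
Proof.
elim: L j => //= L IHL j; have := IHL j.+1; have := ltn_ord (W j).
by rewrite expnS; case: ifP => _; nia.
Qed.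

(** The first digit dominates by [key_bound], and complementing the tails reverses their
    comparison. *)
Lemma key_ltS W L i j :
  (key W L.+1 i < key W L.+1 j) =
  (W i < W j) || (W i == W j) &&
    (if neg (W i) then key W L j.+1 < key W L i.+1
     else key W L i.+1 < key W L j.+1).
Proof.
have digit (a b u v x : nat) : u < x -> v < x ->
    (a * x + u < b * x + v) = (a < b) || (a == b) && (u < v).
  by move=> lt_ux lt_vx; case: (ltngtP a b) => [lt_ab|lt_ba|->] /=; nia.
have bi := key_bound W L i.+1; have bj := key_bound W L j.+1.
rewrite /= digit; try by case: ifP => _ //; lia.
rewrite val_eqE; case: eqP => [->|] //=.
by case: ifP => _; rewrite ?ltnn //=; lia.
Qed.

Lemma key_eqP W L i j :
  key W L i = key W L j <-> forall t, t < L -> W (i + t) = W (j + t).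
Proof.
elim: L i j => [|L IHL] i j; first by split.
split=> [eq_k | eq_W].
  have nlt a b : key W L.+1 a = key W L.+1 b -> (key W L.+1 a < key W L.+1 b) = false.
    by move=> ->; rewrite ltnn.
  have := nlt _ _ eq_k; have := nlt _ _ (esym eq_k); rewrite !key_ltS.
  case: (ltngtP (W i) (W j)) => //= /val_inj eq_ij.
  rewrite eq_ij eqxx /= => h1 h2.
  have /IHL eq_t : key W L i.+1 = key W L j.+1.
    by move: h1 h2; case: ifP => _; lia.
  by case=> [|t] lt_t; rewrite ?addn0 // !addnS -!addSn eq_t.
have eq0 : W i = W j by have := eq_W 0 isT; rewrite !addn0.
suff /IHL eq_k : forall t, t < L -> W (i.+1 + t) = W (j.+1 + t).
  by rewrite /= eq0 eq_k.
by move=> t lt_t; rewrite !addSnnS eq_W.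
Qed.

(** One more letter can only break ties of the shorter comparison. *)
Lemma key_lt_trunc W L i j :
  key W L i < key W L j -> key W L.+1 i < key W L.+1 j.
Proof.
elim: L i j => [//|L IHL] i j; rewrite (key_ltS _ L) (key_ltS _ L.+1).
case: eqP => [->|_]; last by rewrite !andFb !orbF.
rewrite !ltnn !orFb !andTb.
by case: ifP => _; apply: IHL.
Qed.

End SignedWords.

(** * The rankings compatible with a given word *)

Section CompatibleOrders.
Variables (k : nat) (sigma : k.+1.-tuple bool) (n : nat).
Implicit Types (w : word k.+1 n.+1) (r : 'S_n.+1).

(* [r i] is the rank of the [i]-th cyclic shift of [w] in a linear order of the
   shifts that refines the signed lexicographic order. *)
Definition compatible w r := [forall i, forall j,
  ((tnth w i < tnth w j) ==> (r i < r j)) &&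
  ((tnth w i == tnth w j) && (i != j) ==>
     ((r (ordS i) < r (ordS j)) == (r i < r j) (+) neg sigma (tnth w i)))].

(** [inZp] reduces modulo [n.+1], so shifts can be followed along all multiples of a period. *)
Definition rank r j : nat := r (inZp j).

Lemma rankP r i j : (rank r i = rank r j) <-> (i = j %[mod n.+1]).
Proof.
split=> [/val_inj/perm_inj/(congr1 val) // | eq_ij].
by rewrite /rank; congr (val (r _)); apply: val_inj.
Qed.

Lemma cyc_tnth w j : cyc ord0 w j = tnth w (inZp j).
Proof. by rewrite (tnth_nth ord0) /cyc /= size_tuple. Qed.

Lemma compatibleP w r (W := cyc ord0 w) :
  reflect ((forall i j, W i < W j -> rank r i < rank r j) /\
    (forall i j, W i = W j -> i <> j %[mod n.+1] ->
     (rank r i.+1 < rank r j.+1) = (rank r i < rank r j) (+) neg sigma (W i)))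
  (compatible w r).
Proof.
have ordS_inZp j : ordS (inZp j : 'I_n.+1) = inZp j.+1.
  by apply: val_inj; rewrite /= -addn1 modnDml addn1.
apply: (iffP forallP) => [cwr | [c1 c2] i]; last first.
  apply/forallP => j; rewrite -[i]valZpK -[j]valZpK -!cyc_tnth !ordS_inZp.
  apply/andP; split; apply/implyP; first exact: c1.
  case/andP=> /eqP eq_ij ne_ij; apply/eqP/c2 => // eq_mod; case/eqP: ne_ij.
  exact: val_inj.
split=> i j; have /forallP/(_ (inZp j))/andP[c1 c2] := cwr (inZp i).
  by rewrite /W !cyc_tnth => /(implyP c1).
move=> eq_ij ne_ij; move: c2; rewrite -!cyc_tnth -/W eq_ij eqxx /= !ordS_inZp.
by case: eqP => [/(congr1 val) //| _ /eqP].
Qed.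

Lemma period_cyc_word w : period (cyc ord0 w) n.+1.
Proof. by rewrite -{2}(size_tuple w); apply: period_size. Qed.

Lemma rankD r i l : rank r (i + l * n.+1) = rank r i.
Proof. by apply/rankP; rewrite addnC modnMDl. Qed.

(** Each step over a common letter keeps the comparison, or reverses it at a negative letter; the
    reversals add up to the parity of the block. *)
Lemma rank_shift w r i j l (W := cyc ord0 w) : compatible w r ->
    (forall t, t < l -> W (i + t) = W (j + t)) -> i <> j %[mod n.+1] ->
  (rank r (i + l) < rank r (j + l)) = (rank r i < rank r j) (+) parity sigma W i l.
Proof.
move=> /compatibleP[_ c2]; elim: l i j => [|l IHl] i j eq_W ne_ij.
  by rewrite !addn0 addbF.
have eq0 : W i = W j by have := eq_W 0 isT; rewrite !addn0.
rewrite !addnS -!addSn IHl; first by rewrite c2 // parityS addbA.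
  by move=> t lt_t; rewrite !addSnnS eq_W.
by move/eqP; rewrite -(addn1 i) -(addn1 j) eqn_modDr => /eqP.
Qed.

(* With an even number of negative letters in a period [d], the ranks of the
   shifts by [0], [d], [2 d], ... would be monotone, yet they are cyclic. *)
Lemma compatible_period_odd w r d (W := cyc ord0 w) : compatible w r ->
  period W d -> ~~ (n.+1 %| d) -> parity sigma W 0 d.
Proof.
move=> cwr Wd n_d; apply/negPn/negP => even_d.
have ne_t t : t * d <> t.+1 * d %[mod n.+1].
  move/eqP; rewrite mulSn -{1}[t * d]add0n eqn_modDr mod0n eq_sym => /eqP/eqP.
  exact/negP.
have step t : (rank r (t.+1 * d) < rank r (t.+2 * d))
            = (rank r (t * d) < rank r (t.+1 * d)).
  have := @rank_shift w r (t * d) (t.+1 * d) d cwr _ (ne_t t).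
  rewrite -!mulSnr => ->; last first.
    by move=> l _; rewrite mulSnr -addnA [d + l]addnC addnA -/W Wd.
  have -> : parity sigma W (t * d) d = parity sigma W 0 d.
    by rewrite -[t * d]add0n parity_period //; apply: periodM.
  by rewrite (negbTE even_d) addbF.
have stepT t : (rank r (t * d) < rank r (t.+1 * d)) = (rank r 0 < rank r d).
  by elim: t => [|t IHt]; rewrite ?mul0n ?mul1n // step.
have rank0 : rank r (n.+1 * d) = rank r 0 by rewrite mulnC -[_ * _]add0n rankD.
have ne0 := ne_t 0; rewrite mul0n mul1n in ne0.
case: (ltngtP (rank r 0) (rank r d)) => [lt0 | gt0 | /rankP //].
  have mono t : rank r 0 < rank r (t.+1 * d).
    elim: t => [|t IHt]; first by rewrite mul1n.
    by apply: ltn_trans IHt _; rewrite stepT.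
  by have := mono n; rewrite rank0 ltnn.
have mono t : rank r (t.+1 * d) < rank r 0.
  elim: t => [|t IHt]; first by rewrite mul1n.
  apply: leq_ltn_trans _ IHt; rewrite leqNgt stepT -leqNgt; exact: ltnW.
by have := mono n; rewrite rank0 ltnn.
Qed.

Definition tied w i j := forall t, cyc ord0 w (i + t) = cyc ord0 w (j + t).

Lemma tied_period w i j : i <= j -> tied w i j -> period (cyc ord0 w) (j - i).
Proof.
(* Adding [i * n] completes the offset [i] to the multiple [i * n.+1] of the length, which
   periodicity removes. *)
move=> le_ij tie t; have := tie (t + i * n).
have -> : i + (t + i * n) = t + i * n.+1 by lia.
have -> : j + (t + i * n) = t + (j - i) + i * n.+1 by nia.
by rewrite !(periodM i (@period_cyc_word w)).
Qed.

Lemma key_tied w i j :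
  key sigma (cyc ord0 w) n.+1 i = key sigma (cyc ord0 w) n.+1 j <-> tied w i j.
Proof.
split=> [/key_eqP eq_W t | tie]; last by apply/key_eqP.
have cycE l : cyc ord0 w (l + t) = cyc ord0 w (l + t %% n.+1).
  by rewrite {1}(divn_eq t n.+1) addnCA addnC periodM //; apply: period_cyc_word.
by rewrite (cycE i) (cycE j) eq_W // ltn_pmod.
Qed.

(** For shifts that are not tied, the first differing letter decides the comparison, and
    [rank_shift] carries it back to the start; only ties leave freedom. *)
Lemma compatible_inj w r1 r2 : compatible w r1 -> compatible w r2 ->
    (forall i j, tied w i j -> (rank r1 i < rank r1 j) = (rank r2 i < rank r2 j)) ->
  r1 = r2.
Proof.
move=> c1 c2 eq_tied; apply: perm_order_inj => a b.
rewrite -[a]valZpK -[b]valZpK -!/(rank _ _); move: (val a) (val b) => i j.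
have [tie | no_tie] := pselect (tied w i j); first exact: eq_tied.
have /asboolP ex_l : `[< exists l, cyc ord0 w (i + l) != cyc ord0 w (j + l) >].
  apply/asboolP; apply: contrapT => no_l; apply: no_tie => l; apply/eqP.
  by apply: contrapT => /negP ne; apply: no_l; exists l.
case: (ex_minnP ex_l) => l ne_l min_l.
have eq_lt t : t < l -> cyc ord0 w (i + t) = cyc ord0 w (j + t).
  by move=> lt_tl; apply/eqP; apply: contraLR lt_tl => /min_l; rewrite -leqNgt.
have ne_ij : i <> j %[mod n.+1].
  move=> eq_ij; case/eqP: ne_l; rewrite /cyc !size_tuple.
  by rewrite -modnDml eq_ij modnDml.
have last_lt r : compatible w r -> (rank r (i + l) < rank r (j + l)) =
                 (cyc ord0 w (i + l) < cyc ord0 w (j + l)).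
  move=> /compatibleP[lt_r _]; apply/idP/idP; last exact: lt_r.
  case: (ltngtP (cyc ord0 w (i + l)) (cyc ord0 w (j + l))) => // [/lt_r | /val_inj/eqP].
    by rewrite ltnNge => /negbTE gt_l /ltnW; rewrite gt_l.
  by rewrite (negbTE ne_l).
have := last_lt _ c1; have := last_lt _ c2; rewrite !(rank_shift _ eq_lt) //.
by move=> <- /addIb.
Qed.

(* The bit [b] orders the shifts that the signed lexicographic order ties. *)
Lemma compatible_exists w (b : nat -> bool) (W := cyc ord0 w) :
    (forall i, b (i + n.+1) = b i) ->
    (forall i j, tied w i j -> i <> j %[mod n.+1] ->
       b j = ~~ b i /\ b i.+1 = b i (+) neg sigma (W i)) ->
  exists2 r, compatible w r
    & forall i j, tied w i j -> (rank r i < rank r j) = ~~ b i && b j.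
Proof.
(* Doubling keeps the order of the keys and leaves room for [b], which decides only between equal
   keys. *)
move=> b_per b_tie; pose V := key sigma W n.+1; pose K i := (V i).*2 + b i.
have bM i l : b (i + l * n.+1) = b i by exact: (periodM l b_per).
have K_mod i : K i = K (i %% n.+1).
  rewrite /K; have -> : b i = b (i %% n.+1) by rewrite {1}(divn_eq i n.+1) addnC bM.
  congr (_.*2 + _); apply/key_tied => t; rewrite /cyc !size_tuple.
  by rewrite modnDml.
have [|r rK] := @perm_of_key n.+1 (fun i => K i).
  move=> i j eq_K; apply: val_inj; apply: contrapT => ne_ij.
  have eq_V : V i = V j by move: eq_K; rewrite /K; case: (b i) (b j) => [] [] /=; lia.
  have [|b_j _] := b_tie _ _ ((key_tied _ _ _).1 eq_V).
    by rewrite !modn_small.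
  by move: eq_K; rewrite /K eq_V b_j; case: (b i) => /=; lia.
have rankK i j : (rank r i < rank r j) = (K i < K j).
  by rewrite /rank rK /= -!K_mod.
have K_lt i j : V i < V j -> K i < K j.
  by rewrite /K; case: (b i) (b j) => [] [] /=; lia.
(* The prefix is first lengthened by one letter, so that removing the first letter leaves keys of
   length [n.+1] again. *)
have ltV i j : W i = W j -> V i < V j ->
    if neg sigma (W i) then V j.+1 < V i.+1 else V i.+1 < V j.+1.
  by move=> eq_W /key_lt_trunc; rewrite key_ltS eq_W ltnn eqxx.
exists r; last first.
  move=> i j /key_tied eq_V; rewrite rankK /K (eq_V : V i = V j).
  by case: (b i) (b j) => [] [] /=; lia.
apply/compatibleP; split=> i j; rewrite -/W => hW.
  by rewrite rankK; apply: K_lt; rewrite /V key_ltS hW.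
move=> ne_ij; rewrite !rankK.
case: (ltngtP (V i) (V j)) => [lt_V | gt_V | eq_V].
- rewrite (K_lt _ _ lt_V) /=; have := ltV _ _ hW lt_V.
  case: ifP => _ /K_lt //= gt_K; apply/negbTE; rewrite -leqNgt; exact: ltnW.
- have -> : (K i < K j) = false by apply/negbTE; rewrite -leqNgt ltnW ?K_lt.
  have := ltV _ _ (esym hW) gt_V; rewrite -hW.
  case: ifP => _ /K_lt //= gt_K; apply/negbTE; rewrite -leqNgt; exact: ltnW.
have /key_tied tie := eq_V.
have tieS : tied w i.+1 j.+1 by move=> t; rewrite !addSnnS.
have tie' : tied w j i by move=> t.
have [b_j bS_i] := b_tie _ _ tie ne_ij.
have [_ bS_j] := b_tie _ _ tie' (fun e => ne_ij (esym e)).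
have /key_tied eq_VS := tieS; rewrite -/W in eq_VS.
rewrite /K (eq_VS : V i.+1 = V j.+1) eq_V bS_i bS_j -hW b_j.
by case: (b i) (neg _ _) => [] [] /=; lia.
Qed.

Lemma compatible_primitive w : primitive w -> #|[set r | compatible w r]| = 1.
Proof.
move=> /(primitiveP _ (ltn0Sn n)) prim_w.
have tie_mod i j : tied w i j -> i = j %[mod n.+1].
  wlog le_ij : i j / i <= j => [wl tie | /(tied_period le_ij)/prim_w].
    by case/orP: (leq_total i j) => /wl // h; [apply: h | apply/esym/h => t].
  by rewrite -eqn_mod_dvd // => /eqP.
(* A constant bit is allowed because no two distinct shifts are tied. *)
have [//|i j /tie_mod // |r cwr _] := @compatible_exists w (fun=> false).
apply/eqP/cards1P; exists r; apply/setP => r'; rewrite !inE.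
apply/idP/eqP => [cwr' | -> //]; apply: compatible_inj cwr' cwr _ => i j /tie_mod eq_ij.
by rewrite (rankP r i j).2 // (rankP r' i j).2 // !ltnn.
Qed.

(** Distinct tied shifts are half a turn apart. Comparing the shifts by 0 and [m] settles all other
    ties by [rank_shift], and both outcomes occur. *)
Lemma compatible_square w m (q : word k.+1 m) :
    primitive q -> odd (o_sigma sigma q) -> val w = q ++ q ->
  #|[set r | compatible w r]| = 2.
Proof.
move=> prim_q odd_q def_w; pose W := cyc ord0 w.
have sz_q : size q = m by rewrite size_tuple.
have def_n : n.+1 = m + m by rewrite -(size_tuple w) def_w size_cat sz_q.
have m_gt0 : 0 < m by lia.
have W_q : W =1 cyc ord0 q by move=> j; rewrite /W def_w cyc_cat_self.
have Wm : period W m.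
  by move=> j; rewrite !W_q -[in LHS]cyc_modn sz_q modnDr -{2}sz_q cyc_modn.
have par_m : parity sigma W 0 m.
  by have := parity_cyc sigma q; rewrite sz_q /parity (eq_map W_q) => ->.
pose p i := parity sigma W 0 i.
have pm i : p (i + m) = ~~ p i.
  by rewrite /p addnC parityD par_m add0n -{1}[m]add0n parity_period.
have pS i : p i.+1 = p i (+) neg sigma (W i).
  by rewrite /p -addn1 parityD add0n parityS addbF.
have tie_m i j : tied w i j -> i = j %[mod m].
  wlog le_ij : i j / i <= j => [wl tie | /(tied_period le_ij) Wd].
    by case/orP: (leq_total i j) => /wl // h; [apply: h | apply/esym/h => t].
  apply/esym/eqP; rewrite eqn_mod_dvd //; move/(primitiveP _ m_gt0): prim_q; apply.
  by move=> t; rewrite -!W_q /W Wd.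
have tie_mod i j : tied w i j -> i <> j %[mod n.+1] -> j = i + m %[mod n.+1].
  move=> /tie_m eq_m; rewrite def_n addnn -mul2n => ne_ij.
  have red l : l = (l %/ m) * m + l %% m := divn_eq l m.
  have mod2 l : l = (odd (l %/ m)) * m + l %% m %[mod 2 * m].
    rewrite {1}(red l) -{1}(odd_double_half (l %/ m)) mulnDl -addnA addnCA.
    by rewrite -muln2 -mulnA modnMDl.
  have modS l : l + m = (~~ odd (l %/ m)) * m + l %% m %[mod 2 * m].
    by rewrite mod2 divnDr // divnn m_gt0 addn1 /= modnDr.
  rewrite modS mod2 eq_m; congr ((_ * m + _) %% _).
  by move: ne_ij; rewrite (mod2 i) (mod2 j) eq_m; case: odd; case: odd.
have tie0m : tied w 0 m by move=> t; rewrite add0n addnC -/W Wm.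
have ne0m : 0 <> m %[mod n.+1] by rewrite !modn_small //; lia.
(* The running parity [p] flips over [m] steps, so it is a valid tie-breaking bit; adding [~~ c]
   selects the outcome. *)
have ex_r (c : bool) : exists2 r, compatible w r & (rank r 0 < rank r m) = c.
  have [| |r cwr /(_ _ _ tie0m)] := @compatible_exists w (fun i => p i (+) ~~ c).
  - by move=> i; rewrite def_n addnA !pm negbK.
  - move=> i j tie ne_ij; rewrite pS addbAC; split=> //.
    have p_mod l : p l = p (l %% n.+1).
      rewrite {1}(divn_eq l n.+1) addnC; set a := _ %% _.
      elim: (_ %/ _) => [|t IHt]; first by rewrite addn0.
      by rewrite mulSnr def_n !addnA !pm negbK -def_n.
    by rewrite (p_mod j) (tie_mod _ _ tie ne_ij) -p_mod pm addNb.
  have p0 : p 0 = false by [].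
  have p_m : p m = true by [].
  by rewrite p0 p_m => r_c; exists r => //; rewrite r_c; case: c {r_c}.
rewrite -card_bool -cardsT; have -> : [set: bool] =
    [set rank r 0 < rank r m | r in [set r | compatible w r]].
  apply/setP => c; rewrite inE; have [r cwr <-] := ex_r c.
  by symmetry; apply: imset_f; rewrite inE.
rewrite card_in_imset // => r1 r2; rewrite !inE => c1 c2 eq0.
apply: (compatible_inj c1 c2) => i j tie.
have [eq_ij | ne_ij] := eqVneq (i %% n.+1) (j %% n.+1).
  by rewrite (rankP r1 i j).2 // (rankP r2 i j).2 // !ltnn.
have /eqP/(tie_mod _ _ tie) def_j := ne_ij.
rewrite (rankP r1 j (i + m)).2 // (rankP r2 j (i + m)).2 //.
rewrite [i + m]addnC -[i in X in X < _]add0n -[i in X in _ = (X < _)]add0n !(@rank_shift w) //.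
by rewrite eq0.
Qed.

(** Every way of writing [w] as a proper power has exponent 2 and an odd base; this also forbids the
    base to be a proper power. *)
Lemma compatible_nonprimitive w r : compatible w r -> ~ primitive w ->
  exists q : word k.+1 n.+1./2,
    [/\ primitive q, odd (o_sigma sigma q) & val w = q ++ q].
Proof.
move=> cwr.
have power (s : seq 'I_k.+1) e : 1 < e -> val w = flatten (nseq e s) ->
    e = 2 /\ odd (count (neg sigma) s).
  move=> e_gt1 def_w.
  have def_n : n.+1 = e * size s by rewrite -(size_tuple w) def_w size_flatten_nseq.
  have W_s j : cyc ord0 w j = cyc ord0 s j by rewrite def_w cyc_flatten_nseq //; lia.
  have Ws : period (cyc ord0 w) (size s) by move=> j; rewrite !W_s cycDsize.
  have par_s : parity sigma (cyc ord0 w) 0 (size s).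
    apply: compatible_period_odd cwr Ws _; apply/negP => /dvdn_leq.
    by rewrite def_n; nia.
  split; last by rewrite -parity_cyc /parity -(eq_map W_s).
  (* The doubled period has even parity, so it is a multiple of [n.+1], which forces [e] to be 2. *)
  have /dvdn_leq : n.+1 %| size s + size s.
    apply: contraT => n_2s; have := compatible_period_odd cwr _ n_2s.
    rewrite parityD parity_period // par_s; apply=> j.
    by rewrite addnA !Ws.
  by rewrite def_n; nia.
move=> not_prim.
have [s [e [e_gt1 def_w]]] : exists s e, 1 < e /\ val w = flatten (nseq e s).
  exact: contrapT not_prim.
have [e2 odd_s] := power _ _ e_gt1 def_w.
have {}def_w : val w = s ++ s by rewrite def_w e2 /= cats0.
have def_n : n.+1 = size s + size s by rewrite -(size_tuple w) def_w size_cat.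
have half_n : n.+1./2 = size s by rewrite def_n addnn doubleK.
have [q def_q] : exists q : word k.+1 n.+1./2, val q = s.
  by exists (tcast (esym half_n) (in_tuple s)); apply: val_tcast.
exists q; split; rewrite /o_sigma ?(def_q : tval q = s) //.
case=> s' [e' [e'_gt1]]; rewrite def_q => def_s.
(* If [s] were an [e']-th power, [w] would be a power of exponent [e' + e'], which exceeds 2. *)
have [| | e'_2 _] := power s' (e' + e'); first by lia.
  by rewrite def_w def_s nseqD flatten_cat.
by lia.
Qed.

End CompatibleOrders.

(** * Cyclic permutations as conjugates of the rotation *)

Section CyclicPermutations.
Variable n : nat.
Implicit Types (r s : 'S_n.+1).

Definition rotation : 'S_n.+1 := perm (@ordS_inj n.+1).

Lemma cyclic_permP s : cyclic_perm s <-> forall x, porbit s x = setT.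
Proof.
split=> [/cards1P[A orbA] x | orbT]; last first.
  apply/cards1P; exists setT; apply/setP => A; rewrite inE.
  apply/imsetP/eqP => [[x _ ->] // | ->]; by exists ord0.
have orbE y : porbit s y = A.
  by apply/set1P; rewrite -orbA; apply: imset_f.
by apply/setP => y; rewrite inE orbE -(orbE y) porbit_id.
Qed.

Lemma iter_conj_rotation r j : iter j (rotation ^ r)%g (r ord0) = r (inZp j).
Proof.
elim: j => [|j IHj] /=.
  by congr (r _); apply: val_inj; rewrite /= mod0n.
rewrite IHj permJ permE; congr (r _); apply: val_inj.
by rewrite /= -addn1 modnDml addn1.
Qed.

Lemma cyclic_conj_rotation r : cyclic_perm (rotation ^ r)%g.
Proof.
have orb0 y : y \in porbit (rotation ^ r)%g (r ord0).
  apply/porbitP; exists (val ((r^-1)%g y)); rewrite permX iter_conj_rotation.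
  by rewrite valZpK permKV.
apply/cyclic_permP => x; apply/setP => y; rewrite inE.
have /eqP-> : porbit (rotation ^ r)%g x == porbit (rotation ^ r)%g (r ord0).
  by rewrite eq_porbit_mem orb0.
exact: orb0.
Qed.

(** The conjugator lists the orbit [x], [s x], [s (s x)], ..., which exhausts the indices because
    there is a single cycle. *)
Lemma cyclic_is_conj_rotation s x : cyclic_perm s ->
  exists2 r, (rotation ^ r)%g = s & r ord0 = x.
Proof.
move=> /cyclic_permP orbT.
have card_orb : #|porbit s x| = n.+1 by rewrite orbT cardsT card_ord.
have inj_f : injective (fun i : 'I_n.+1 => iter i s x).
  move=> i j eq_ij; apply: val_inj; apply/eqP.
  have := uniq_traject_porbit s x; rewrite card_orb => uniq_t.
  rewrite -(nth_uniq x _ _ uniq_t) ?size_traject ?ltn_ord //.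
  by rewrite !nth_traject ?ltn_ord //; apply/eqP.
exists (perm inj_f); last by rewrite permE.
apply/permP => y; rewrite -[y](permKV (perm inj_f)); set i := ((perm inj_f)^-1)%g y.
rewrite permJ !permE -iterS /=.
have [lt_i | le_i] := ltnP i.+1 n.+1; first by rewrite modn_small.
have def_i : i.+1 = n.+1 by apply/eqP; rewrite eqn_leq le_i ltn_ord.
have := iter_porbit s x; rewrite card_orb => iter_n.
by rewrite -[RHS]/(iter i.+1 s x) def_i modnn iter_n.
Qed.

(** A ranking amounts to the cyclic permutation it yields and the image of 0, which is free: hence
    the factor [n.+1]. *)
Lemma card_conj_rotation (P : pred 'S_n.+1) :
  #|[set r | P (rotation ^ r)%g]| = #|[set s | cyclic_perm s && P s]| * n.+1.
Proof.
pose h r := ((rotation ^ r)%g, r ord0).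
have inj_h : injective h.
  move=> r1 r2 [eq_c eq_0]; apply/permP => i.
  by rewrite -[i]valZpK -!iter_conj_rotation eq_c eq_0.
rewrite -[LHS](card_imset _ inj_h) -[X in _ * X](card_ord n.+1) -cardsT -cardsX.
apply: eq_card => -[s x]; rewrite !inE andbT /=; apply/imsetP/andP.
  by case=> r; rewrite inE => Pr [-> _]; rewrite cyclic_conj_rotation.
case=> /(cyclic_is_conj_rotation x)[r <- <-] Ps.
by exists r; rewrite ?inE.
Qed.

(** This provides the descent from which the cuttings are counted. *)
Lemma rotation_neq1 r : 0 < n -> (rotation ^ r)%g != 1%g.
Proof.
move=> n_gt0; rewrite -(conj1g r) (inj_eq (conjg_inj r)).
apply/eqP => /permP/(_ ord0); rewrite permE perm1 => /(congr1 val) /=.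
by rewrite modn_small.
Qed.

End CyclicPermutations.

(** * From words with a ranking to labelled permutations *)

Section Labellings.
Variables (k : nat) (sigma : k.+1.-tuple bool) (n : nat).
Implicit Types (f w : word k.+1 n.+1) (r s : 'S_n.+1).

(** This is [compatible] read by rank: [f a] is the first letter of the shift of rank [a], and [s a]
    is the rank of the next shift. *)
Definition labels f s := [forall a, forall b,
  ((tnth f a < tnth f b) ==> (a < b)) &&
  ((tnth f a == tnth f b) && (a != b) ==>
     ((s a < s b) == (a < b) (+) neg sigma (tnth f a)))].

Lemma labelsP f s :
  reflect ((forall a b, tnth f a < tnth f b -> a < b) /\
    (forall a b, tnth f a = tnth f b -> a != b ->
     (s a < s b) = (a < b) (+) neg sigma (tnth f a)))
  (labels f s).
Proof.
apply: (iffP forallP) => [lfs | [l1 l2] a]; last first.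
  apply/forallP => b; apply/andP; split; apply/implyP; first exact: l1.
  by case/andP=> /eqP eq_ab ne_ab; apply/eqP/l2.
split=> a b; have /forallP/(_ b)/andP[l1 l2] := lfs a; first exact: implyP.
by move=> eq_ab ne_ab; move: l2; rewrite eq_ab eqxx ne_ab => /eqP.
Qed.

Lemma card_compatible_words r :
  #|[set w | compatible sigma w r]| = #|[set f | labels f (rotation n ^ r)%g]|.
Proof.
pose F f : word k.+1 n.+1 := [tuple tnth f (r i) | i < n.+1].
have inj_F : injective F.
  move=> f g eq_F; apply: eq_from_tnth => a.
  have := congr1 (fun t => tnth t ((r^-1)%g a)) eq_F.
  by rewrite !tnth_mktuple permKV.
rewrite -(card_preimset _ inj_F); apply: eq_card => f; rewrite !inE.
have conjE a : (rotation n ^ r)%g a = r (ordS ((r^-1)%g a)).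
  by rewrite -{1}[a](permKV r) permJ permE.
apply/forallP/forallP => h.
  move=> a; apply/forallP => b.
  have /forallP/(_ ((r^-1)%g b)) := h ((r^-1)%g a).
  by rewrite !tnth_mktuple !permKV !conjE (inj_eq perm_inj).
move=> i; apply/forallP => j; have /forallP/(_ (r j)) := h (r i).
by rewrite !tnth_mktuple !conjE !permK (inj_eq perm_inj).
Qed.

End Labellings.

(** * Cuttings of a permutation into increasing, decreasing and increasing segments *)

Section UpDownUp.
Variables (n : nat) (s : 'S_n.+1).
Hypothesis s_neq1 : s != 1%g.

(** One-line notation indexed by [nat]; [inord] sends indices beyond [n] to 0, so the indices have
    to be bounded. *)
Let line (a : nat) : nat := s (inord a).

Definition cuts e1 e2 := [/\ e1 <= e2, e2 <= n.+1 &
  forall a, a < n -> [/\ a.+1 < e1 -> line a < line a.+1,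
    e1 <= a -> a.+1 < e2 -> line a.+1 < line a & e2 <= a -> line a < line a.+1]].

Lemma line_ord (a : 'I_n.+1) : line a = s a.
Proof. by rewrite /line inord_val. Qed.

Lemma line_inj a b : a <= n -> b <= n -> line a = line b -> a = b.
Proof.
move=> le_a le_b /val_inj/perm_inj/(congr1 val).
by rewrite /= !inordK.
Qed.

Lemma line_ltNge a : a < n -> (line a < line a.+1) = ~~ (line a.+1 < line a).
Proof.
move=> lt_a; case: ltngtP => // /line_inj eq_a.
by have := eq_a (ltnW lt_a) lt_a; lia.
Qed.

Lemma sigma3_classP :
  in_sigma_class (val sigma3t) s <-> exists e1 e2, cuts e1 e2.
Proof.
split=> [[e [e_0 e_3 le_e mono]] | [e1 [e2 [le12 le2n cut]]]].
  rewrite /= in e_3 le_e mono; exists (e 1), (e 2); split.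
  - exact: (le_e 1).
  - by rewrite -e_3; apply: (le_e 2).
  move=> a lt_a.
  have adj i : i < 3 -> e i <= a -> a.+1 < e i.+1 ->
      if nth true [:: true; false; true] i then line a < line a.+1 else line a.+1 < line a.
    move=> lt_i le_ia lt_ai; have := mono i lt_i (inord a) (inord a.+1).
    by rewrite /= !inordK ?ltnS // ?(ltnW lt_a) //; apply.
  split=> [lt1 | le1 lt2 | le2].
  - by apply: (adj 0); rewrite ?e_0.
  - exact: (adj 1).
  - by apply: (adj 2); rewrite // e_3.
exists (nth 0 [:: 0; e1; e2; n.+1]); split=> //=.
  by case=> [|[|[|]]].
move=> i lt_i a b def_b; rewrite -!line_ord def_b.
have lt_a : a < n by have := ltn_ord b; rewrite def_b.
have [c1 c2 c3] := cut a lt_a.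
case: i lt_i => [|[|[|//]]] _ /=; [by move=> _ | exact: c2 | by move=> /c3].
Qed.

Lemma line_mono x y : y <= n.+1 ->
    (forall a, x <= a -> a.+1 < y -> line a < line a.+1) ->
  forall a b, x <= a -> a < b -> b < y -> line a < line b.
Proof.
move=> le_y step a b le_xa; elim: b => // b IHb; rewrite ltnS leq_eqVlt.
case/predU1P => [<- | lt_ab] lt_by; first exact: step.
apply: ltn_trans (IHb lt_ab (ltnW lt_by)) (step _ _ lt_by).
exact: leq_trans le_xa (ltnW lt_ab).
Qed.

Lemma line_anti x y : y <= n.+1 ->
    (forall a, x <= a -> a.+1 < y -> line a.+1 < line a) ->
  forall a b, x <= a -> a < b -> b < y -> line b < line a.
Proof.
move=> le_y step a b le_xa; elim: b => // b IHb; rewrite ltnS leq_eqVlt.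
case/predU1P => [<- | lt_ab] lt_by; first exact: step.
apply: ltn_trans (step _ _ lt_by) (IHb lt_ab (ltnW lt_by)).
exact: leq_trans le_xa (ltnW lt_ab).
Qed.

(** Without descents the permutation would be increasing, hence the identity. *)
Lemma descent_exists : exists a, (a < n) && (line a.+1 < line a).
Proof.
apply: contrapT => no_desc; case/eqP: s_neq1.
have up a : 0 <= a -> a.+1 < n.+1 -> line a < line a.+1.
  move=> _; rewrite ltnS => lt_a; rewrite line_ltNge //; apply/negP => desc.
  by apply: no_desc; exists a; rewrite lt_a.
have mono (i j : 'I_n.+1) : i < j -> s i < s j.
  by move=> lt_ij; rewrite -!line_ord; apply: (line_mono (leqnn _) up).
apply: perm_order_inj => i j; rewrite !perm1; apply/idP/idP; last exact: mono.
case: (ltngtP i j) => // [/mono | /val_inj ->]; last by rewrite ltnn.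
by rewrite ltnNge => /negbTE gt_ij /ltnW; rewrite gt_ij.
Qed.

(** The first descent is not before [e1.-1] and the last one is before [e2], so every position
    strictly between them lies in the decreasing segment. *)
Lemma descent_interval e1 e2 : cuts e1 e2 -> exists p v,
  [/\ p < v, v <= n & forall a, a < n -> (line a.+1 < line a) = (p <= a < v)].
Proof.
case=> le12 le2n cut.
have bd a : (a < n) && (line a.+1 < line a) -> a <= n by case/andP => /ltnW.
case: (ex_minnP descent_exists) => p /andP[lt_p desc_p] min_p.
case: (ex_maxnP descent_exists bd) => v /andP[lt_v desc_v] max_v.
(* The interval is half-open: its upper end is one past the last descent. *)
exists p, v.+1; split=> [||a lt_a].
- by rewrite ltnS; apply: min_p; rewrite lt_v.
- exact: lt_v.
apply/idP/idP => [desc_a | /andP[le_pa]].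
  by rewrite min_p ?lt_a //= ltnS max_v ?lt_a.
rewrite ltnS => le_av.
have [c1 c2 c3] := cut a lt_a.
have [p1 _ _] := cut p lt_p; have [_ _ v3] := cut v lt_v.
case: (ltngtP p a) le_pa => // [lt_pa _ | <- //].
case: (ltngtP a v) le_av => // [lt_av _ | -> //].
by apply: c2; lia.
Qed.

(** The peak [p] may close the first segment or open the second, and the valley [v] may close the
    second or open the third. *)
Lemma cutsP p v e1 e2 :
    p < v -> v <= n -> (forall a, a < n -> (line a.+1 < line a) = (p <= a < v)) ->
  cuts e1 e2 <-> (e1 = p \/ e1 = p.+1) /\ (e2 = v \/ e2 = v.+1).
Proof.
move=> lt_pv le_vn desc; split=> [[le12 le2n cut] | def_e].
  have up a : a < n -> (line a < line a.+1) = ~~ (p <= a < v).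
    by move=> lt_a; rewrite line_ltNge // desc.
  have cut' a : a < n -> [/\ a.+1 < e1 -> ~~ (p <= a < v),
      e1 <= a -> a.+1 < e2 -> p <= a < v & e2 <= a -> ~~ (p <= a < v)].
    by move=> lt_a; rewrite -up // -desc //; apply: cut.
  (* The extreme descents, at [p] and [v.-1], give one bound on each cut; beyond the other bound,
     the ascent at [e1] or at [v] would fall into the decreasing segment. *)
  have [p1 p2 p3] := cut' p (leq_trans lt_pv le_vn).
  have [|v1 v2 v3] := cut' v.-1; first by lia.
  have le_e1p : e1 <= p.+1 by lia.
  have le_ve2 : v <= e2 by lia.
  have le_pe1 : p <= e1.
    case: (leqP p e1) => // lt_e1p.
    by have [|_ q2 _] := cut' e1; lia.
  have le_e2v : e2 <= v.+1.
    case: (leqP e2 v.+1) => // lt_ve2.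
    by have [|_ q2 _] := cut' v; lia.
  lia.
split; [lia | lia | move=> a lt_a].
by rewrite line_ltNge // desc //; split; lia.
Qed.

Definition step_labels e1 e2 : word 3 n.+1 :=
  [tuple if a < e1 then ord0 else if a < e2 then inord 1 else ord_max | a < n.+1].

Lemma step_labelsE e1 e2 a :
  tnth (step_labels e1 e2) a = (if a < e1 then 0 else if a < e2 then 1 else 2) :> nat.
Proof.
by rewrite tnth_mktuple; case: ifP => // _; case: ifP => // _; rewrite /= inordK.
Qed.

Lemma neg_sigma3 (x : 'I_3) : neg sigma3t x = (val x == 1).
Proof. by rewrite /neg (tnth_nth true); case: x => [[|[|[|]]]]. Qed.

Lemma labels_step e1 e2 : cuts e1 e2 -> labels sigma3t (step_labels e1 e2) s.
Proof.
case=> le12 le2n cut.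
have up1 : forall a b, 0 <= a -> a < b -> b < e1 -> line a < line b.
  apply: line_mono => [|a _ lt_a]; first by lia.
  by have [|c1 _ _] := cut a; [lia | exact: c1].
have down : forall a b, e1 <= a -> a < b -> b < e2 -> line b < line a.
  apply: line_anti => // a le_a lt_a.
  by have [|_ c2 _] := cut a; [lia | exact: c2].
have up2 : forall a b, e2 <= a -> a < b -> b < n.+1 -> line a < line b.
  apply: line_mono => // a le_a lt_a.
  by have [|_ _ c3] := cut a; [lia | exact: c3].
apply/labelsP; split=> a b; first rewrite !step_labelsE.
  by case: (ltnP a e1) (ltnP b e1) (ltnP a e2) (ltnP b e2) => ? [] ? [] ? [] ? /=; lia.
move=> /(congr1 val); rewrite neg_sigma3 /= !step_labelsE -!line_ord => eq_f ne_ab.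
have lt_a := ltn_ord a; have lt_b := ltn_ord b.
have {ne_ab} : val a <> val b by apply/eqP.
rewrite /=; move: (val a) (val b) lt_a lt_b eq_f => {}a {}b lt_a lt_b eq_f ne_ab.
have u1 := up1 a b; have u1' := up1 b a; have d1 := down a b; have d1' := down b a.
have u2 := up2 a b; have u2' := up2 b a.
move: eq_f.
by case: (ltnP a e1) (ltnP b e1) (ltnP a e2) (ltnP b e2) => ? [] ? [] ? [] ? /=; lia.
Qed.

Lemma downset_threshold (Q : pred 'I_n.+1) :
    (forall a b : 'I_n.+1, a <= b -> Q b -> Q a) ->
  exists2 e, e <= n.+1 & forall a : 'I_n.+1, Q a = (a < e).
Proof.
(* The first disjunct supplies the threshold [n.+1] when [Q] holds everywhere. *)
move=> down; have ex_e : exists e, (n.+1 <= e) || ~~ Q (inord e).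
  by exists n.+1; rewrite leqnn.
case: (ex_minnP ex_e) => e not_e min_e.
exists e => [|a]; first by apply: min_e; rewrite leqnn.
apply/idP/idP => [Qa | lt_ae]; last first.
  apply: contraLR lt_ae => not_a; rewrite -leqNgt; apply: min_e.
  by rewrite inord_val not_a orbT.
rewrite ltnNge; apply/negP => le_ea; case/orP: not_e => [|/negP[]].
  by have := ltn_ord a; lia.
by apply: down Qa; rewrite inordK //; have := ltn_ord a; lia.
Qed.

(** The letters increase weakly, so the places where they reach 1 and 2 determine [f] and serve as
    cuts. *)
Lemma labels_cuts f : labels sigma3t f s ->
  exists e1 e2, cuts e1 e2 /\ f = step_labels e1 e2.
Proof.
case/labelsP => mono seg.
have le_f (a b : 'I_n.+1) : a <= b -> tnth f a <= tnth f b.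
  by move=> le_ab; rewrite leqNgt; apply/negP => /mono; rewrite ltnNge le_ab.
have [|e1 le1 f1] := @downset_threshold (fun a => tnth f a < 1).
  by move=> a b /le_f; apply: leq_ltn_trans.
have [|e2 le2 f2] := @downset_threshold (fun a => tnth f a < 2).
  by move=> a b /le_f; apply: leq_ltn_trans.
have fE a : tnth f a = (if a < e1 then 0 else if a < e2 then 1 else 2) :> nat.
  by rewrite -f1 -f2; have := ltn_ord (tnth f a); do ?[case: ltnP => ?]; lia.
have le12 : e1 <= e2.
  rewrite leqNgt; apply/negP => lt21.
  have lt2n : e2 < n.+1 by lia.
  by have := f1 (Ordinal lt2n); have := f2 (Ordinal lt2n); rewrite /=; lia.
exists e1, e2; split; last first.
  by apply: eq_from_tnth => a; apply: val_inj; rewrite [LHS]fE [RHS]step_labelsE.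
split=> // a lt_a; have lt_aS : a < n.+1 by lia.
have := seg (inord a) (inord a.+1); rewrite neg_sigma3 -(inj_eq val_inj) /= -!/(line _).
have := fE (inord a); have := fE (inord a.+1); rewrite !inordK //.
move=> fS fa adj.
have {}adj : val (tnth f (inord a)) = val (tnth f (inord a.+1)) ->
    (line a < line a.+1) = (a < a.+1) (+) (val (tnth f (inord a)) == 1).
  by move=> /val_inj /adj; apply; rewrite neq_ltn ltnSn.
have gtE := line_ltNge lt_a.
rewrite /= fS fa in adj.
move: adj; rewrite ltnSn.
by case: (ltnP a e1) (ltnP a.+1 e1) (ltnP a e2) (ltnP a.+1 e2)
  => ? [] ? [] ? [] ? /= adj; split; lia.
Qed.

Lemma card_sigma3_labels :
  #|[set f | labels sigma3t f s]| = 4 * `[< in_sigma_class (val sigma3t) s >].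
Proof.
case: asboolP => [/sigma3_classP[e1 [e2 cut]] | not_cls]; last first.
  rewrite muln0; apply/eqP; rewrite cards_eq0; apply/eqP/setP => f; rewrite !inE.
  apply/negP => /labels_cuts[e1 [e2 [cut _]]]; apply: not_cls.
  by apply/sigma3_classP; exists e1, e2.
have [p [v [lt_pv le_vn desc]]] := descent_interval cut.
pose g (b : bool * bool) := step_labels (p + b.1) (v + b.2).
have inj_g : injective g.
  have lt_p : p < n.+1 by lia.
  have lt_v : v < n.+1 by lia.
  move=> [b1 b2] [c1 c2] eq_g.
  (* The letter at [v], 1 or 2, reveals the second bit, and the letter at [p], 0 or 1, reveals the
     first. *)
  have := congr1 (fun t => val (tnth t (Ordinal lt_v))) eq_g.
  have := congr1 (fun t => val (tnth t (Ordinal lt_p))) eq_g.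
  rewrite /= !step_labelsE /=.
  have pp (b : bool) : (p < p + b) = b by case: b; lia.
  have pv (b : bool) : (p < v + b) = true by lia.
  have vp (b : bool) : (v < p + b) = false by case: b; lia.
  have vv (b : bool) : (v < v + b) = b by case: b; lia.
  by rewrite !pp !pv !vp !vv; case: b1 b2 c1 c2 {eq_g} => [] [] [] [].
have -> : [set f | labels sigma3t f s] = [set g b | b : bool * bool].
  apply/setP => f; rewrite inE; apply/idP/imsetP => [|[[b1 b2] _ ->]].
    case/labels_cuts => d1 [d2 [/(cutsP _ _ lt_pv le_vn desc)[h1 h2] ->]].
    by exists (d1 == p.+1, d2 == v.+1) => //; rewrite /g /=; congr step_labels; lia.
  apply/labels_step/(cutsP _ _ lt_pv le_vn desc).
  by case: b1 b2 => [] [] /=; lia.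
by rewrite card_imset // card_prod card_bool.
Qed.

End UpDownUp.

(** * The double count *)

Section Count.
Variable n : nat.

Definition odd_square (w : word 3 n.+1) :=
  `[< exists q : word 3 n.+1./2,
      [/\ primitive q, odd (o_sigma sigma3t q) & val w = q ++ q] >].

Lemma card_compatible_perms (w : word 3 n.+1) :
  #|[set r | compatible sigma3t w r]| = `[< primitive w >] + 2 * odd_square w.
Proof.
rewrite /odd_square; case: (asboolP (primitive w)) => [prim_w | not_prim].
  rewrite compatible_primitive //; case: asboolP => // -[q [_ _ def_w]].
  by case: prim_w; exists q, 2; rewrite /= cats0.
case: asboolP => [[q [prim_q odd_q def_w]] | not_sq].
  exact: compatible_square def_w.
apply/eqP; rewrite cards_eq0; apply/eqP/setP => r; rewrite !inE; apply/negP => cwr.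
by case: not_sq; apply: compatible_nonprimitive cwr not_prim.
Qed.

(** Squaring is a bijection from the odd primitive words of length [m] onto these words; there are
    [m] of them per necklace, and the factor 2 turns [m] into [n.+1]. *)
Lemma card_odd_squares :
  2 * #|[set w | odd_square w]| = (if odd n.+1 then 0 else Lk_sig sigma3t n.+1./2) * n.+1.
Proof.
case: ifP => [odd_n | /negbT even_n].
  apply/eqP; rewrite mul0n muln_eq0 cards_eq0 /=; apply/eqP/setP => w; rewrite !inE.
  apply/negP => /asboolP[q [_ _ /(congr1 size)]].
  by rewrite size_cat !size_tuple; lia.
set m := n.+1./2; have def_n : m + m = n.+1 by rewrite /m; lia.
have m_gt0 : 0 < m by lia.
rewrite -[X in _ = _ * X]def_n addnn -mul2n mulnCA -card_odd_primitive_words //.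
congr (_ * _).
pose g (q : word 3 m) : word 3 n.+1 := tcast def_n [tuple of q ++ q].
have gE q : val (g q) = q ++ q by exact: val_tcast.
have inj_g : injective g.
  move=> q1 q2 /(congr1 val); rewrite !gE => /eqP.
  by rewrite eqseq_cat ?size_tuple // => /andP[/eqP/val_inj].
rewrite -(card_imset _ inj_g); apply: eq_card => w; rewrite inE.
apply/asboolP/imsetP => [[q [prim_q odd_q def_w]] | [q]].
  exists q; first by rewrite inE odd_q andbT; apply/asboolP.
  by apply: val_inj; rewrite gE.
by rewrite inE => /andP[/asboolP prim_q odd_q] ->; exists q; rewrite gE.
Qed.

Lemma c3_Lk_star : 0 < n -> 4 * c3 n.+1 = Lk_star sigma3t n.+1.
Proof.
move=> n_gt0.
(* Both sums count the compatible pairs of a word and a ranking. *)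
have : \sum_(r : 'S_n.+1) #|[set w | compatible sigma3t w r]|
     = \sum_(w : word 3 n.+1) #|[set r | compatible sigma3t w r]|.
  under eq_bigr do rewrite -sum1dep_card big_mkcond.
  by rewrite exchange_big /=; apply: eq_bigr => w _; rewrite -big_mkcond sum1dep_card.
under eq_bigr do rewrite card_compatible_words card_sigma3_labels ?rotation_neq1 //.
under [RHS]eq_bigr do rewrite card_compatible_perms.
have sum_bool (T : finType) (Q : pred T) : \sum_(x : T) (Q x : nat) = #|[set x | Q x]|.
  by rewrite -sum1dep_card [RHS]big_mkcond; apply: eq_bigr => x _; case: (Q x).
have sum_bool_mul c (T : finType) (Q : pred T) :
    \sum_(x : T) c * Q x = c * #|[set x | Q x]| by rewrite -sum_bool big_distrr.
rewrite sum_bool_mul big_split /= sum_bool_mul !sum_bool.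
rewrite (card_conj_rotation (fun s => `[< in_sigma_class (val sigma3t) s >])).
rewrite card_odd_squares card_primitive_words //.
(* The common factor [n.+1] cancels: it counts starting points of a cycle on one side and comes from
   rotations of necklaces on the other. *)
by rewrite mulnA -mulnDl => /eqP; rewrite eqn_pmul2r // => /eqP.
Qed.

End Count.

Import GRing.Theory.
Local Open Scope ring_scope.

Theorem theorem3p1 (n : nat) : (3 <= n)%N ->
  (c3 n)%:R = (Lk_star sigma3t n)%:R / 4 :> rat.
Proof.
case: n => // n n_gt1; rewrite -c3_Lk_star; last exact: ltnW.
by rewrite natrM mulrC mulKf.
Qed.
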